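(* Let $(X,d_X)$ and $(Y,d_Y)$ be continua and let $f : X \to Y$ be a refinable map. If $X$ is colocally connected, then $Y$ is colocally connected.
   Context: A continuum is a nonempty compact connected metrizable space; all maps are continuous. A continuum $X$ is colocally connected if for each $x \in X$ and each neighborhood $V \subseteq X$ of $x$ there exists an open neighborhood $U \subseteq X$ of $x$ such that $x \in U \subseteq V$ and $X \setminus U$ is connected (the empty set is regarded as connected). Let $(X,d_X)$, $(Y,d_Y)$ be continua and $\varepsilon>0$. A surjective map $g : X \to Y$ is an $\varepsilon$-map if for each $y \in Y$ the diameter of $g^{-1}(y)$ with respect to $d_X$ is less than $\varepsilon$. If $g, g_\varepsilon : X \to Y$ are surjective maps such that $g_\varepsilon$ is an $\varepsilon$-map and $d_Y(g(x), g_\varepsilon(x)) < \varepsilon$ for each $x \in X$, then $g_\varepsilon$ is called an $\varepsilon$-refinement of $g$. A surjective map $r : X \to Y$ is a refinable map if for each $\varepsilon > 0$ there exists an $\varepsilon$-refinement $r_\varepsilon : X \to Y$ of $r$. *)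

(* Defs.v *)
From HB Require Import structures.
From mathcomp Require Import all_boot all_order all_algebra.
From mathcomp Require Import boolp classical_sets functions.
From mathcomp Require Import reals constructive_ereal ereal topology.

Set Implicit Arguments.
Unset Strict Implicit.
Unset Printing Implicit Defensive.

Import Order.TTheory GRing.Theory Num.Theory.

Local Open Scope classical_set_scope.
Local Open Scope ring_scope.

(* A metricType may be empty, so nonemptiness is required here; metrizability
   and the chosen metric come from the metricType structure. *)
Definition is_continuum (R : realType) (X : metricType R) : Prop :=
  [/\ [set: X] !=set0, compact [set: X] & connected [set: X]].

(* The library's [connected] holds of set0, so U may be the whole space. *)
Definition colocally_connected (X : topologicalType) : Prop :=
  forall (x : X) (V : set X), nbhs x V ->
    exists U : set X, [/\ open U, U x, U `<=` V & connected (~` U)].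

(* The diameter of set0 is -oo; fibres of surjective maps are nonempty. *)
Definition diameter (R : realType) (X : metricType R) (A : set X) : \bar R :=
  ereal_sup [set (mdist p.1 p.2)%:E | p in A `*` A].

Definition surjective_map (X Y : topologicalType) (g : X -> Y) : Prop :=
  continuous g /\ set_surj [set: X] [set: Y] g.

Definition epsilon_map (R : realType) (X Y : metricType R) (e : R)
    (g : X -> Y) : Prop :=
  surjective_map g /\ forall y : Y, (diameter (g @^-1` [set y]) < e%:E)%E.

Definition epsilon_refinement (R : realType) (X Y : metricType R) (e : R)
    (g ge : X -> Y) : Prop :=
  [/\ surjective_map g, epsilon_map e ge
    & forall x : X, mdist (g x) (ge x) < e].

Definition refinable (R : realType) (X Y : metricType R) (r : X -> Y) : Prop :=
  surjective_map r /\
  forall e : R, 0 < e -> exists re : X -> Y, epsilon_refinement e r re.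

(* Main.v *)
(* Fix y in Y and a neighbourhood V of y.  By compactness of X, the fibres over
   y of finer and finer refinements of f accumulate at some point x, and
   f x = y by uniform closeness.  Take an open U around x with connected
   complement and f(U) close to y.  For a fine enough refinement g whose fibre
   over y meets a small ball around x, that whole fibre lies in U, so the
   complement W of the compact connected set g(X \ U) is an open neighbourhood
   of y; and W is contained in g(U), hence in V because g is close to f. *)
Require Import Defs.
From mathcomp Require Import all_boot all_order all_algebra.
From mathcomp Require Import boolp classical_sets functions.
From mathcomp Require Import reals constructive_ereal ereal topology.
From mathcomp Require Import lra.

Set Implicit Arguments.
Unset Strict Implicit.
Unset Printing Implicit Defensive.

Import Order.TTheory GRing.Theory Num.Theory.

Local Open Scope classical_set_scope.
Local Open Scope ring_scope.

Lemma mdist_lt_diameter (R : realType) (X : metricType R) (A : set X) (e : R)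
    (a b : X) : (diameter A < e%:E)%E -> A a -> A b -> mdist a b < e.
Proof.
move=> Ae Aa Ab; rewrite -lte_fin; apply: le_lt_trans Ae.
by apply: ereal_sup_ubound; exists (a, b).
Qed.

Lemma nbhs_mdistP (R : realType) (X : metricType R) (x : X) (V : set X) :
  nbhs x V <-> exists2 e : R, 0 < e & forall z, mdist x z < e -> V z.
Proof.
by rewrite -metricType_numDomainType.filter_from_mdist_nbhs.
Qed.

Lemma epsilon_refinement_le (R : realType) (X Y : metricType R) (e e' : R)
    (f g : X -> Y) :
  e <= e' -> epsilon_refinement e f g -> epsilon_refinement e' f g.
Proof.
move=> ee' [sf [sg dg] fg]; split=> //.
- by split=> // y; apply: lt_le_trans (dg y) _; rewrite lee_fin.
- by move=> x; apply: lt_le_trans ee'.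
Qed.

(** The point [x] is fixed before [N] and [e], so that colocal connectedness can be applied at [x]
    first and the precision of [g] chosen afterwards. *)
Lemma refinable_fibre_cluster (R : realType) (X Y : metricType R) (f : X -> Y)
    (y : Y) : compact [set: X] -> refinable f ->
  exists2 x : X, f x = y &
    forall (N : set X) (e : R), nbhs x N -> 0 < e ->
      exists x' g, [/\ N x', epsilon_refinement e f g & g x' = y].
Proof.
move=> cX [[cf _] rf].
pose A (e : R) := [set x | exists2 g, epsilon_refinement e f g & g x = y].
(* The sets [A e] shrink with [e], and each is nonempty because refinements are surjective. *)
have FA : ProperFilter (filter_from [set e : R | 0 < e] A).
  apply: filter_from_proper.
    apply: filter_from_filter; first by exists 1 => /=.
    move=> i j i0 j0; exists (Num.min i j) => /=; first by rewrite lt_min i0.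
    by move=> x [g eg gx]; split; exists g => //;
      apply: epsilon_refinement_le eg; rewrite ge_min lexx ?orbT.
  move=> e /rf[g eg]; have [_ [[_ sg] _] _] := eg.
  by have [x _ gx] := sg y I; exists x, g.
have [x [_ clx]] : [set: X] `&` cluster (filter_from [set e : R | 0 < e] A) !=set0.
  by apply: cX => //; exists 1 => /=.
have key (N : set X) (e : R) : nbhs x N -> 0 < e ->
    exists x' g, [/\ N x', epsilon_refinement e f g & g x' = y].
  move=> xN e0; have [|x' [[g eg gx'] Nx']] := clx (A e) N _ xN.
    by exists e.
  by exists x', g.
(* If [f x] and [y] were at distance [d > 0], continuity of [f] at [x] and closeness of [g] to [f],
   each at scale [d / 2], would give [d < d]. *)
exists x => //; apply/eqP; rewrite -[_ == _]negbK -mdist_gt0; apply/negP => d0.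
pose d := mdist (f x) y; have d20 : 0 < d / 2 by rewrite divr_gt0.
have xN : nbhs x [set x' | mdist (f x) (f x') < d / 2].
  exact: metricType_numDomainType.cvgr_dist_lt (cf x) _ d20.
have [x' [g [Nx' [_ _ fg] gx']]] := key _ _ xN d20.
have := metric_triangle (f x) (f x') y; have := fg x'; rewrite gx'.
move: Nx' => /=; rewrite -/d; lra.
Qed.

Theorem theorem2p2 (R : realType) (X Y : metricType R) (f : X -> Y)
    (hX : is_continuum X) (hY : is_continuum Y) (hf : refinable f)
    (hXc : colocally_connected X) :
  colocally_connected Y.
Proof.
move=> y V /nbhs_mdistP[r r0 rV].
have [_ cX _] := hX.
have [x fx key] := refinable_fibre_cluster y cX hf.
have [[cf _] _] := hf.
have r20 : 0 < r / 2 by rewrite divr_gt0.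
have fN : nbhs x [set x' | mdist (f x) (f x') < r / 2].
  exact: metricType_numDomainType.cvgr_dist_lt (cf x) _ r20.
have [U [oU Ux UV cU]] := hXc x _ fN.
have /nbhs_mdistP[d d0 dU] : nbhs x U by apply: open_nbhs_nbhs.
(* The bound [d / 2] is used twice, for the distance from [x] to [x'] and for the diameter of the
   fibre; [r / 2] bounds the distance between [f] and [g], the other half of [r] being spent on [f]
   over [U]. *)
pose e := Num.min (d / 2) (r / 2).
have e0 : 0 < e by rewrite lt_min r20 divr_gt0.
have [ed er] : e <= d / 2 /\ e <= r / 2 by rewrite !ge_min !lexx orbT.
have [|x' [g [xx' [_ [[cg sg] dg] fg] gx']]] :=
  key [set z | mdist x z < e] e _ e0.
  by apply/nbhs_mdistP; exists e.
have cgU : {within ~` U, continuous g} by apply: continuous_subspaceT.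
exists (~` (g @` ~` U)); split.
- rewrite openC; apply: compact_closed; first exact: metric_hausdorff.
  apply: continuous_compact => //.
  by apply: subclosed_compact cX _ => //; rewrite closedC.
- move=> [z nUz gz]; apply: nUz; apply: dU.
  have := mdist_lt_diameter (dg y) gx' gz.
  have := metric_triangle x x' z; move: xx' => /=; lra.
(* Surjectivity of [g] gives a preimage [u] of [w], which must lie in [U] since [w] avoids the image
   of the complement. *)
- move=> w nw; have [u _ gu] := sg w I; apply: rV.
  have Uu : U u by apply: contrapT => nUu; apply: nw; exists u.
  have := UV _ Uu; have := fg u; have := metric_triangle y (f u) w.
  rewrite /= fx gu; lra.
- by rewrite setCK; apply: connected_continuous_connected.
Qed.
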